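(* Let $\mathbb{F}$ be a finite field. For every $k,m,r\in\mathbb{N}$ there is $n$ such that for every $c:M^k_{n,n}(\mathbb{F})\to r$ there are $R_0,R_1\in\mathcal{E}_{n,m}(\mathbb{F})$ such that $\tau^{(2)}$ is a factor of $c$ on $R_0\cdot M^k_{m,m}(\mathbb{F})\cdot R_1^{\mathrm{t}}$, i.e. the color $c(R_0\cdot A\cdot R_1^{\mathrm{t}})$ depends only on $\tau^{(2)}(A)$ for $A\in M^k_{m,m}(\mathbb{F})$.
   Context: $r$ is identified with $\{0,\dots,r-1\}$. $M^k_{n,m}(\mathbb{F})$ is the set of $n\times m$ matrices over $\mathbb{F}$ of rank $k$. With $(u_i)$ the unit basis, a $p\times q$ matrix $A$ is in RREF if there are $p_0\le p$ and $j_0<\dots<j_{p_0-1}<q$ with $Au_{j_i}=u_i$ and $\langle Au_j\rangle_{j<j_i}=\langle u_l\rangle_{l<i}$ for $i<p_0$; it is in RCEF if its transpose is in RREF. $\mathcal{E}_{n,k}(\mathbb{F})$ is the set of $n\times k$ matrices of rank $k$ in RCEF. $\tau^{(2)}:M^k_{n,n}(\mathbb{F})\to\mathrm{GL}(\mathbb{F}^k)$ is the map uniquely determined by $A=A_0\cdot\tau^{(2)}(A)\cdot A_1^{\mathrm{t}}$ for some $A_0,A_1\in\mathcal{E}_{n,k}(\mathbb{F})$.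
   Formalization: In the definition of RREF the span condition is also required for i = p_0 with j_{p_0} := q (all columns span ⟨u_l⟩_{l<p_0}); without it p_0 = 0 makes every matrix RREF and τ^(2) is not uniquely determined, e.g. for 1×1 matrices. *)

(* Defs.v *)
From HB Require Import structures.
From mathcomp Require Import all_boot all_order all_algebra.
From Stdlib Require Import ClassicalEpsilon.
Set Implicit Arguments. Unset Strict Implicit. Unset Printing Implicit Defensive.
Import GRing.Theory.
Local Open Scope ring_scope.

Section Defs.
Variable F : fieldType.

(* span of the columns A u_c with c < t, as a row space (columns transposed) *)
Definition colspan_lt (p q : nat) (A : 'M[F]_(p, q)) (t : nat) : 'M[F]_(q, p) :=
  \matrix_(c < q) (if (c < t)%N then (col c A)^T else 0).

Definition unitspan_lt (p : nat) (i : nat) : 'M[F]_(p, p) :=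
  \matrix_(l < p) (if (l < i)%N then delta_mx 0 l else 0).

(* reduced row echelon form of a p x q matrix; convention j_{p0} := q *)
Definition is_rref (p q : nat) (A : 'M[F]_(p, q)) : Prop :=
  exists (p0 : nat) (j : nat -> nat),
    [/\ (p0 <= p)%N,
        (forall i, (i < p0)%N -> (j i < q)%N),
        (forall i1 i2, (i1 < i2)%N -> (i2 < p0)%N -> (j i1 < j i2)%N),
        (forall (i : 'I_p) (c : 'I_q), (i < p0)%N -> nat_of_ord c = j i ->
            col c A = delta_mx i 0) &
        (forall i, (i <= p0)%N ->
            (colspan_lt A (if (i < p0)%N then j i else q) == unitspan_lt p i)%MS)].

Definition is_rcef (p q : nat) (A : 'M[F]_(p, q)) : Prop := is_rref A^T.

Definition in_E (n k : nat) (A : 'M[F]_(n, k)) : Prop :=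
  \rank A = k /\ is_rcef A.

Definition tau2 (n k : nat) (A : 'M[F]_n) : 'M[F]_k :=
  epsilon (inhabits 0) (fun G : 'M[F]_k => G \in unitmx /\
    exists A0 A1 : 'M[F]_(n, k), [/\ in_E A0, in_E A1 & A = A0 *m G *m A1^T]).

End Defs.

(* Main.v *)
(** A matrix of rank k factors as A0 * G * A1^t with A0, A1 in RCEF, so a
    colouring of such matrices is a colouring of pairs (A0, A1) by functions of
    G, and it suffices to make the latter constant.  For a single factor this is
    a Ramsey theorem for RCEF matrices under left multiplication by an RCEF
    matrix.  It follows from the dual Ramsey theorem of Graham and Rothschild:
    enumerate F^k in base #|F| (antilexicographically, with the digits 0 and 1
    denoting the scalars 0 and 1) and read a matrix as the word of its rows.
    Every rigid word of this kind is a matrix in RCEF, and conversely v |-> v A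
    is a rigid map for each A in RCEF.

    The dual Ramsey theorem is proved by induction on the number of parameters:
    its instance with one more constant makes the colour of a word depend only
    on the part before the first parameter, and the Hales-Jewett theorem then
    deals with these prefixes. *)
Require Import Defs.
From mathcomp Require Import all_boot all_order all_algebra.
From mathcomp Require Import all_fingroup.
From Stdlib Require Import ClassicalEpsilon.
Set Implicit Arguments. Unset Strict Implicit. Unset Printing Implicit Defensive.
Import GRing.Theory.

(** * Parameter words and the dual Ramsey theorem *)

(* Restricted growth words: the letters below [a] are constants, and the
   parameters [a], [a.+1], ... first occur in this order, the last one being
   [b.-1].  For [b = a] these are the words over the alphabet [a]. *)
Fixpoint rgs (a : nat) (w : seq nat) (b : nat) : bool :=
  if w is x :: w' then (x < a) && rgs a w' b || (x == a) && rgs a.+1 w' b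
  else a == b.

(* Substitution of the word [g] for the parameters [a], [a.+1], ... *)
Definition sub (a : nat) (g : seq nat) (x : nat) := nth 0 (iota 0 a ++ g) x.
Definition subst (a : nat) (g f : seq nat) := map (sub a g) f.
Arguments subst : simpl never.

Lemma subst_letter a g x f : subst a g (x :: f) = sub a g x :: subst a g f.
Proof. by []. Qed.

Lemma rgs_leq a w b : rgs a w b -> a <= b.
Proof.
elim: w a => [|x w IH] a /=; first by move/eqP->.
by case/orP=> /andP[_ /IH] // /ltnW.
Qed.

Lemma rgs_lt a w b : rgs a w b -> all (fun x => x < b) w.
Proof.
elim: w a => [|x w IH] a //=.
case/orP=> /andP[xa H]; rewrite (IH _ H) andbT; have := rgs_leq H.
  exact: leq_trans.
by rewrite (eqP xa).
Qed.

Lemma rgs_size a w b : rgs a w b -> b <= a + size w.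
Proof.
elim: w a => [|x w IH] a /=; first by move/eqP->; rewrite addn0.
case/orP=> /andP[_ /IH H]; apply: leq_trans H _; by rewrite ?addnS ?addSn.
Qed.

Lemma rgs_cat a w1 b w2 c : rgs a w1 b -> rgs b w2 c -> rgs a (w1 ++ w2) c.
Proof.
elim: w1 a => [|x w IH] a /=; first by move/eqP->.
by case/orP=> /andP[-> H] H2; rewrite (IH _ H H2) ?orbT.
Qed.

Lemma rgs_const a w : rgs a w a = all (fun x => x < a) w.
Proof.
elim: w => [|x w IH] /=; first by rewrite eqxx.
rewrite IH; case: (boolP (rgs a.+1 w a)) => [/rgs_leq|_]; first by rewrite ltnn.
by rewrite andbF orbF.
Qed.

Lemma rgs_iota a n : rgs a (iota a n) (a + n).
Proof.
elim: n a => [|n IH] a /=; first by rewrite addn0.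
by rewrite ltnn eqxx /= addnS -addSn IH.
Qed.

Lemma rgs_bump a w b e : e <= a -> rgs a w b -> rgs a.+1 (map (bump e) w) b.+1.
Proof.
elim: w a => [|x w IH] a ea //=; rewrite /bump.
case/orP=> /andP[xa H].
  apply/orP; left; rewrite (IH _ ea H) andbT.
  by case: (e <= x) => //; apply: ltnW.
by rewrite (eqP xa) ea add1n eqxx (IH _ _ H) ?orbT // ltnW.
Qed.

Lemma rgs_addn a w b e : rgs a w b -> rgs (a + e) (map (addn^~ e) w) (b + e).
Proof.
elim: w a => [|x w IH] a /=; first by move/eqP->.
by rewrite ltn_add2r eqn_add2r => /orP[] /andP[-> /IH]; rewrite ?addSn => ->;
  rewrite ?orbT.
Qed.

Lemma sub_lt a g1 g2 e x :
  rgs a g1 e -> x < a + size g1 -> sub a (g1 ++ g2) x < e.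
Proof.
move=> H xl; rewrite /sub nth_cat size_iota.
case: (ltnP x a) => [xa|ax].
  by rewrite nth_iota // add0n (leq_trans xa) // (rgs_leq H).
rewrite nth_cat ltn_subLR // xl; apply: (allP (rgs_lt H)); apply: mem_nth.
by rewrite ltn_subLR.
Qed.

Lemma sub_nth a g i : sub a g (a + i) = nth 0 g i.
Proof. by rewrite /sub nth_cat size_iota ltnNge leq_addr addKn. Qed.

Lemma sub_head a y g : sub a (y :: g) a = y.
Proof. by have := sub_nth a (y :: g) 0; rewrite addn0. Qed.

Lemma sub_id a g x : x < a -> sub a g x = x.
Proof. by move=> xa; rewrite /sub nth_cat size_iota xa nth_iota. Qed.

Lemma rgs_subst a f g c :
  rgs a f (a + size g) -> rgs a g c -> rgs a (subst a g f) c.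
Proof.
(* [g] is split as [g1 ++ g2]: [g1] belongs to the parameters of [f] met so far, and [e] is the next
   new letter of the result. *)
suff H g1 g2 e : rgs a g1 e -> rgs e g2 c ->
    rgs (a + size g1) f (a + size (g1 ++ g2)) -> rgs e (subst a (g1 ++ g2) f) c.
  by move=> ? ?; apply: (H [::]); rewrite /= ?addn0.
elim: f g1 g2 e => [|x f IH] g1 g2 e Hg1 Hg2 /=.
  rewrite size_cat eqn_add2l -{1}[size g1]addn0 eqn_add2l eq_sym => /nilP g20.
  by move: Hg2; rewrite g20.
case/orP=> /andP[xa Hf].
  by apply/orP; left; rewrite (sub_lt _ Hg1 xa) IH.
case: g2 Hg2 Hf => [|y g2] Hg2 Hf.
  by have := rgs_leq Hf; rewrite cats0 ltnn.
rewrite (eqP xa) sub_nth nth_cat ltnn subnn /=.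
move: Hf; rewrite -cat_rcons -addnS -(size_rcons g1 y) => Hf.
case/orP: Hg2 => /andP[ye Hg2]; apply/orP; [left|right]; rewrite ye /=;
  apply: IH => //; rewrite -cats1; apply: rgs_cat Hg1 _;
  by rewrite /= ye eqxx ?orbT.
Qed.

Lemma size_subst a g f : size (subst a g f) = size f.
Proof. exact: size_map. Qed.

Lemma subst_cat a g f1 f2 : subst a g (f1 ++ f2) = subst a g f1 ++ subst a g f2.
Proof. exact: map_cat. Qed.

Lemma subst_const a g f : all (fun x => x < a) f -> subst a g f = f.
Proof.
by move=> H; rewrite -[RHS]map_id; apply/eq_in_map => x /(allP H); apply: sub_id.
Qed.

Lemma substA a b g h f : a <= b -> all (fun x => x < a + size g) f ->
  subst b h (subst a g f) = subst a (subst b h g) f.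
Proof.
move=> ab H; rewrite /subst -map_comp; apply/eq_in_map => x /(allP H) xl /=.
have [xa|ax] := ltnP x a; first by rewrite !(sub_id _ xa) sub_id ?(leq_trans xa).
rewrite -(subnKC ax) !sub_nth (nth_map 0) //.
by rewrite ltn_subLR.
Qed.

(** The letter [a] can be read as one more constant or as a parameter replaced by itself; this links
    the alphabets [a] and [a.+1]. *)
Lemma substS a g f : subst a.+1 g f = subst a (a :: g) f.
Proof.
by apply: eq_map => x; rewrite /sub -addn1 iotaD -catA /= add0n.
Qed.

Lemma sub_bump a y g x : sub a (y :: g) (bump a x) = sub a g x.
Proof.
rewrite /bump; case: leqP => ax; last by rewrite add0n !sub_id.
by rewrite -(subnKC ax) add1n -addnS !sub_nth.
Qed.

Lemma subst_bump a y g f : subst a (y :: g) (map (bump a) f) = subst a g f.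
Proof. by rewrite /subst -map_comp; apply: eq_map => x /=; rewrite sub_bump. Qed.

(** Substituting [a :: map (bump a) h] keeps the first parameter of [f] free and puts [h] for the
    others, so [y] and [v] act independently. *)
Lemma subst_cons a y v h f : all (fun x => x <= a + size h) f ->
  subst a (y :: v) (subst a (a :: map (bump a) h) f)
  = subst a (y :: subst a v h) f.
Proof.
move=> H; rewrite substA //=; last by rewrite size_map addnS.
by rewrite subst_letter subst_bump sub_head.
Qed.

(** * Colourings of words and the Hales-Jewett theorem *)

(** The Graham-Rothschild statement over [a] constants; for [k = 0] it is the multidimensional
    Hales-Jewett theorem. *)
Definition dual_ramsey (a k : nat) := forall (m : nat) (C : finType),
  exists n, forall c : seq nat -> C,
  exists2 f, rgs a f (a + m) /\ size f = n & forall g g',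
    size g = m -> size g' = m -> rgs a g (a + k) -> rgs a g' (a + k) ->
    c (subst a g f) = c (subst a g' f).

Definition line_ramsey (a : nat) := forall (C : finType),
  exists n, forall c : seq nat -> C,
  exists2 f, rgs a f a.+1 /\ size f = n & forall y y', y < a -> y' < a ->
    c (subst a [:: y] f) = c (subst a [:: y'] f).

Lemma tuple_of_word a n (w : seq nat) : size w = n -> all (fun x => x < a) w ->
  exists t : n.-tuple 'I_a, w = map val t.
Proof.
elim: w n => [|x w IH] [|n] //=; first by exists [tuple].
case=> /IH H /andP[xa /H[t ->]].
by exists [tuple of Ordinal xa :: t].
Qed.

(** Induction on the dimension: a line in a first block, good for every continuation, is followed by
    a space in a second block. *)
Lemma hales_jewett_of_line a : 0 < a -> line_ramsey a -> dual_ramsey a 0.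
Proof.
move=> a0 L; elim=> [|m IH] C.
  exists 0 => c; exists [::]; first by rewrite /= addn0.
  by move=> [|? ?] [|? ?].
have [n2 {}IH] := IH C; have [n1 {}L] := L {ffun n2.-tuple 'I_a -> C}.
exists (n1 + n2) => c.
(* The colour of [u] is the whole function [v |-> c (u ++ v)]; it has finitely many values as [v]
   has a fixed length. *)
have [f1 [Hf1 s1] L1] := L (fun u => [ffun v : n2.-tuple 'I_a => c (u ++ map val v)]).
have [f2 [Hf2 s2] L2] := IH (fun v => c (subst a [:: 0] f1 ++ v)).
exists (f1 ++ map (bump a) f2).
  split; last by rewrite size_cat size_map s1 s2.
  by apply: rgs_cat Hf1 _; rewrite addnS; apply: rgs_bump.
have K y v : all (fun x => x < a) (y :: v) -> size v = m ->
    c (subst a (y :: v) (f1 ++ map (bump a) f2)) =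
    c (subst a [:: 0] f1 ++ subst a v f2).
  case/andP=> ya va sv; rewrite subst_cat subst_bump.
  have -> : subst a (y :: v) f1 = subst a [:: y] f1.
    apply/eq_in_map => x /(allP (rgs_lt Hf1)); rewrite ltnS leq_eqVlt.
    case/orP=> [/eqP->|xa]; last by rewrite !sub_id.
    by rewrite !sub_head.
  have [||t ->] := @tuple_of_word a n2 (subst a v f2).
  - by rewrite size_subst.
  - by rewrite -rgs_const; apply: rgs_subst; rewrite ?sv // rgs_const.
  by have /ffunP/(_ t) := L1 _ _ ya a0; rewrite !ffunE.
move=> [|y g] [|y' g'] //= [sg] [sg']; rewrite !addn0 => Hg Hg'.
rewrite !K -?rgs_const //; apply: L2 => //; rewrite addn0 rgs_const;
by move: Hg Hg'; rewrite -![_ || _]/(rgs a (_ :: _) a) !rgs_const => /andP[_ Hg] /andP[].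
Qed.

(* Iterating Hales-Jewett makes the colour of [a^i w] independent of the word
   [w] over the alphabet [a], simultaneously for all [i]. *)
Lemma staircase a : dual_ramsey a 0 -> forall d (C : finType),
  exists n, forall c : seq nat -> C,
  exists2 f, rgs a f (a + d) /\ size f = n & forall i w w',
    i + size w = d -> size w' = size w ->
    all (fun x => x < a) w -> all (fun x => x < a) w' ->
    c (subst a (nseq i a ++ w) f) = c (subst a (nseq i a ++ w') f).
Proof.
move=> H; elim=> [|d IH] C.
  exists 0 => c; exists [::]; first by rewrite addn0 /=.
  by [].
have [n2 {}IH] := IH C; have [n {}H] := H n2.+1 C.
exists n => c.
have [f0 [Hf0 s0] H0] := H c.
(* [f0] settles the case [i = 0]. For [i > 0] the first letter is [a], which is fixed in this
   colouring. *)
have [f2 [Hf2 s2] H2] := IH (fun v => c (subst a (a :: v) f0)).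
have lf0 : all (fun x => x <= a + size f2) f0.
  by have := rgs_lt Hf0; rewrite s2 addnS.
exists (subst a (a :: map (bump a) f2) f0).
  split; last by rewrite size_subst.
  apply: rgs_subst; first by rewrite /= size_map s2.
  by rewrite /= ltnn eqxx addnS /=; apply: rgs_bump.
case=> [|i] w w' /=.
  case: w w' => [|y v] [|y' v'] //= [sv] [sv'] Hw Hw'.
  rewrite !subst_cons //.
  have K z u : all (fun x => x < a) (z :: u) -> size u = d ->
     rgs a (z :: subst a u f2) (a + 0).
    rewrite addn0 rgs_const /= => /andP[-> ?] su.
    by rewrite -rgs_const rgs_subst ?su // rgs_const.
  by apply: H0; rewrite /= ?size_subst ?s2 //; apply: K => //; rewrite sv'.
by rewrite addSn => -[sw] sw' Hw Hw'; rewrite !subst_cons //; apply: H2.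
Qed.

(* In a staircase of dimension #|C| two words [a^i 0 ... 0] and [a^j 0 ... 0]
   with [i < j] get the same colour; letting positions [i] to [j - 1] vary gives
   the line. *)
Lemma line_step a : 0 < a -> dual_ramsey a 0 -> line_ramsey a.+1.
Proof.
move=> a0 /staircase H C; have [n {}H] := H #|C| C; exists n => c.
have [f [Hf sf] Hc] := H c.
pose p i := nseq i a ++ nseq (#|C| - i) 0.
have [i [j [ij jC cij]]] : exists i j, [/\ i < j, j <= #|C| &
    c (subst a (p i) f) = c (subst a (p j) f)].
  pose h (i : 'I_#|C|.+1) := c (subst a (p i) f).
  have /injectivePn[x [y xy hxy]] : ~~ injectiveb h.
    by apply/injectiveP => /leq_card; rewrite card_ord ltnn.
  have [lt|lt|/val_inj e] := ltngtP x y.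
  - by exists x, y; split; rewrite // -ltnS.
  - by exists y, x; split; rewrite // -ltnS.
  - by rewrite e eqxx in xy.
pose g := nseq i a ++ nseq (j - i) a.+1 ++ nseq (#|C| - j) 0.
have sg : size g = #|C|.
  by rewrite !size_cat !size_nseq; rewrite addnA subnKC ?subnKC // ltnW.
exists (subst a g f).
  split; last by rewrite size_subst.
  (* [f] is shifted so that [a] becomes a constant and the parameters start at [a.+1]. *)
  rewrite -(subst_bump a a) -substS; apply: rgs_subst.
    by rewrite sg addSn; apply: rgs_bump.
  apply: (@rgs_cat _ _ a.+1); first by rewrite rgs_const all_nseq ltnSn orbT.
  rewrite -(subnSK ij) /= ltnn eqxx /=.
  by rewrite rgs_const all_cat !all_nseq ltnSn !orbT.
suff K y : y < a.+1 -> c (subst a.+1 [:: y] (subst a g f)) = c (subst a (p i) f).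
  by move=> y y' /K-> /K->.
move=> ya; rewrite substA //; last by rewrite sg; apply: rgs_lt Hf.
have -> : subst a.+1 [:: y] g = nseq i a ++ nseq (j - i) y ++ nseq (#|C| - j) 0.
  rewrite !subst_cat; congr (_ ++ _).
    by apply: subst_const; rewrite all_nseq ltnSn orbT.
  congr (_ ++ _); last by apply: subst_const; rewrite all_nseq orbT.
  by rewrite /subst map_nseq sub_head.
(* For [y = a] the word is [p j]; for [y < a] it is [a^i] followed by a word over [a], so the
   staircase applies. *)
move: ya; rewrite ltnS leq_eqVlt => /orP[/eqP->|ya].
  rewrite cij /p; congr (c (subst _ _ _)).
  by rewrite catA -nseqD subnKC // ltnW.
have iC : i <= #|C| by apply: leq_trans jC; apply: ltnW.
apply: Hc.
- by rewrite size_cat !size_nseq addnA subnKC ?subnKC // ltnW.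
- apply/eqP; rewrite size_cat !size_nseq -(eqn_add2l i) addnA subnKC //.
  by rewrite !subnKC // ltnW.
- by rewrite all_cat !all_nseq ya a0 !orbT.
- by rewrite all_nseq a0 orbT.
Qed.

Lemma hales_jewett a : 0 < a -> dual_ramsey a 0.
Proof.
(* Induction on the alphabet; over the single letter 0 there is one word of each length. *)
case: a => // a _; elim: a => [|a IH].
  move=> m C; exists m => c; exists (iota 1 m).
    by rewrite size_iota rgs_iota.
  move=> g g' sg sg'; rewrite addn0 !rgs_const.
  suff K h : all (fun x => x < 1) h -> h = nseq (size h) 0.
    by move=> /K-> /K->; rewrite sg sg'.
  by elim: h => //= x h IH /andP[]; rewrite ltnS leqn0 => /eqP-> /IH {1}->.
by apply: hales_jewett_of_line => //; apply: line_step.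
Qed.

(** * Prefixes up to the first parameter *)

Definition pre (a : nat) (u : seq nat) := take (find (leq a) u) u.

Lemma size_pre a u : size (pre a u) = find (leq a) u.
Proof. by rewrite size_take_min; apply/minn_idPl/find_size. Qed.

Lemma pre_all a u : all (fun x => x < a) (pre a u).
Proof.
rewrite /pre; elim: u => //= x u IH; case: leqP => //= xa.
by rewrite xa.
Qed.

(** The first letter of [f] that is at least [a + i] is [a + i] itself, by restricted growth. Both
    images are cut there at the latest, and before it they agree. *)
Lemma pre_map a i (s s' : nat -> nat) b f c : rgs b f c -> b <= a + i ->
  (forall x, x < a + i -> s x = s' x) -> a <= s (a + i) -> a <= s' (a + i) ->
  pre a (map s f) = pre a (map s' f).
Proof.
move=> H bi ss' si s'i; rewrite /pre.
elim: f b H bi => //= x f IH b H bi.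
case: (ltnP x (a + i)) => [xi|ix].
  rewrite -(ss' x xi); case: leqP => //= _; congr (_ :: _).
  by case/orP: H => /andP[xb /IH]; apply=> //; rewrite -(eqP xb).
suff -> : x = a + i by rewrite si s'i.
apply/eqP; rewrite eqn_leq ix andbT; apply: leq_trans bi.
by case/orP: H => /andP[]; [move/ltnW|move/eqP->].
Qed.

Lemma pre_subst a u u' f b : rgs a f b ->
  has (leq a) u -> has (leq a) u' -> pre a u = pre a u' ->
  pre a (subst a u f) = pre a (subst a u' f).
Proof.
move=> H hu hu' e.
have e' : find (leq a) u = find (leq a) u' by rewrite -!size_pre e.
apply: (pre_map H (leq_addr (find (leq a) u) a)) => [x xi||].
- have [xa|ax] := ltnP x a; first by rewrite !sub_id.
  rewrite -(subnKC ax) !sub_nth.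
  have xl : x - a < find (leq a) u by rewrite ltn_subLR.
  by rewrite -(nth_take 0 xl) -[take _ u]/(pre a u) e /pre -e' nth_take.
- by rewrite sub_nth; apply: (@nth_find _ 0 (leq a)).
- by rewrite sub_nth e'; apply: (@nth_find _ 0 (leq a)).
Qed.

Lemma rgs_mem a w b x : rgs a w b -> a <= x < b -> x \in w.
Proof.
elim: w a => [|y w IH] a /=; first by move/eqP-> => /andP[ax]; rewrite ltnNge ax.
rewrite inE; case/orP=> /andP[ya H] /andP[ax xb].
  by rewrite (IH _ H) ?orbT ?ax.
move: ax; rewrite leq_eqVlt => /orP[/eqP<-|ax]; first by rewrite eq_sym ya.
by rewrite (IH _ H) ?orbT ?ax.
Qed.

Lemma has_subst a g f : rgs a f (a + size g) -> has (leq a) g ->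
  has (leq a) (subst a g f).
Proof.
move=> H /(has_nthP 0)[i ig ai]; rewrite has_map; apply/hasP; exists (a + i).
  by apply: (rgs_mem H); rewrite leq_addr ltn_add2l.
by rewrite /= sub_nth.
Qed.

Lemma subst_widen a g g' f : all (fun x => x < a + size g) f ->
  subst a (g ++ g') f = subst a g f.
Proof.
move=> H; apply/eq_in_map => x /(allP H) xl.
have [xa|ax] := ltnP x a; first by rewrite !sub_id.
by rewrite -(subnKC ax) !sub_nth nth_cat ltn_subLR // xl.
Qed.

(** Induction on [m], with a fresh parameter appended at the end. If only the last letter of [g] is
    a parameter, the prefix is [f1] filled with constants and Hales-Jewett applies; otherwise the
    last letter lies beyond the prefix and the induction hypothesis applies. *)
Lemma prefix_levels a : dual_ramsey a 0 -> forall m (C : finType),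
  exists n, forall c : seq nat -> C,
  exists2 f, rgs a f (a + m) /\ size f = n & forall g g',
    size g = m -> size g' = m -> has (leq a) g ->
    find (leq a) g = find (leq a) g' ->
    c (pre a (subst a g f)) = c (pre a (subst a g' f)).
Proof.
move=> HJ; elim=> [|m IH] C.
  by exists 0 => c; exists [::]; [rewrite addn0 /= | case].
have [N {}IH] := IH C; have [n {}HJ] := HJ N C.
exists n.+1 => c.
have [f1 [Hf1 s1] H1] := HJ c.
(* The prefix [v] is padded to length [N] with the letter [a]; by [pre_subst] what follows the first
   parameter does not affect the result. *)
have [f2 [Hf2 s2] H2] := IH (fun v =>
  c (pre a (subst a (v ++ nseq (N - size v) a) f1))).
exists (rcons (subst a f2 f1) (a + m)).
  split; last by rewrite size_rcons size_subst s1.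
  rewrite -cats1; apply: (@rgs_cat _ _ (a + m)).
    by apply: rgs_subst; rewrite ?s2.
  by rewrite /= ltnn eqxx addnS /=.
have K g0 z : size g0 = m -> subst a (rcons g0 z) (rcons (subst a f2 f1) (a + m))
    = rcons (subst a (subst a g0 f2) f1) z.
  move=> sg; rewrite -!cats1 subst_cat subst_letter substA ?s2 ?(rgs_lt Hf1) //.
  by rewrite subst_widen ?sg ?(rgs_lt Hf2) // sub_nth -sg nth_cat ltnn subnn.
have Kfull g0 z : size g0 = m -> has (leq a) (rcons g0 z) -> ~~ has (leq a) g0 ->
    all (fun x => x < a) (subst a g0 f2) /\
    pre a (rcons (subst a (subst a g0 f2) f1) z) = subst a (subst a g0 f2) f1.
  rewrite has_rcons -all_predC => sg hz Hg0.
  have {}Hg0 : all (fun x => x < a) g0.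
    by apply: sub_all Hg0 => x /=; rewrite ltnNge.
  move: hz; have /negPf-> : ~~ has (leq a) g0.
    by rewrite -all_predC; apply: sub_all Hg0 => x /=; rewrite -ltnNge.
  rewrite orbF => az.
  have A2 : all (fun x => x < a) (subst a g0 f2).
    by rewrite -rgs_const rgs_subst ?sg // rgs_const.
  have A1 : all (fun x => x < a) (subst a (subst a g0 f2) f1).
    by rewrite -rgs_const rgs_subst ?size_subst ?s2 // rgs_const.
  split=> //; rewrite /pre -cats1 find_cat.
  have /negPf-> : ~~ has (leq a) (subst a (subst a g0 f2) f1).
    by rewrite -all_predC; apply: sub_all A1 => x /=; rewrite -ltnNge.
  by rewrite /= az addn0 take_size_cat.
have Kpart g0 z : size g0 = m -> has (leq a) g0 ->
    let v := pre a (subst a g0 f2) in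
    c (pre a (rcons (subst a (subst a g0 f2) f1) z)) =
    c (pre a (subst a (v ++ nseq (N - size v) a) f1)).
  move=> sg hg v.
  have hu : has (leq a) (subst a g0 f2) by apply: has_subst; rewrite ?sg.
  have hu1 : has (leq a) (subst a (subst a g0 f2) f1).
    by apply: has_subst; rewrite ?size_subst ?s2.
  have -> : pre a (rcons (subst a (subst a g0 f2) f1) z) =
            pre a (subst a (subst a g0 f2) f1).
    by rewrite /pre -cats1 find_cat hu1 takel_cat // find_size.
  have hN : size v < N by rewrite /v size_pre -s2 -(size_subst a g0) -has_find.
  have nv : find (leq a) v = size v.
    apply: hasNfind; rewrite -all_predC.
    by apply: sub_all (pre_all a (subst a g0 f2)) => x /=; rewrite -ltnNge.
  have hw : find (leq a) (v ++ nseq (N - size v) a) = size v.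
    rewrite find_cat nv has_find nv ltnn -(subnSK hN) /= leqnn addn0 //.
  congr c; apply: (pre_subst Hf1) => //.
    by rewrite has_find hw size_cat size_nseq subnKC // ltnW.
  by rewrite [RHS]/pre hw take_size_cat.
elim/last_ind=> [|g0 z _] // g'; elim/last_ind: g' => [|g0' z' _] //.
rewrite !size_rcons => -[sg] [sg'] hg e; rewrite !K //.
have hg' : has (leq a) (rcons g0' z') by rewrite has_find -e size_rcons sg' -sg -(size_rcons g0 z) -has_find.
have L g1 y : size g1 = m -> has (leq a) (rcons g1 y) ->
    has (leq a) g1 = (find (leq a) (rcons g1 y) < m).
  move=> sg1 h1; rewrite -cats1 find_cat; case: ifP => H; first by rewrite -sg1 -has_find.
  by rewrite sg1 ltnNge leq_addr.
have e' : has (leq a) g0 = has (leq a) g0' by rewrite (L _ z sg hg) (L _ z' sg' hg') e.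
have [h|h] := boolP (has (leq a) g0); last first.
  have [A B] := Kfull _ _ sg hg h; rewrite e' in h.
  have [A' B'] := Kfull _ _ sg' hg' h.
  by rewrite B B'; apply: H1; rewrite ?size_subst ?addn0 ?rgs_const.
have h' := h; rewrite e' in h'.
rewrite !Kpart //; apply: H2 => //.
by move: e; rewrite -!cats1 !find_cat h h'.
Qed.

(** Parameters go to the first [r] marked positions and the constant 0 elsewhere; this restricts a
    word to chosen levels. *)
Fixpoint word_of_mask (a r : nat) (b : bitseq) : seq nat :=
  match b, r with
  | [::], _ => [::]
  | true :: b', r'.+1 => a :: word_of_mask a.+1 r' b'
  | _ :: b', _ => 0 :: word_of_mask a r b'
  end.

Lemma size_word_of_mask a r b : size (word_of_mask a r b) = size b.
Proof. by elim: b a r => [|[] b IH] a [|r] //=; rewrite IH. Qed.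

Lemma rgs_word_of_mask a r b : 0 < a -> r <= count id b ->
  rgs a (word_of_mask a r b) (a + r).
Proof.
elim: b a r => [|x b IH] a r a0; first by rewrite leqn0 => /eqP->; rewrite addn0 /=.
case: r => [|r] /=.
  have := IH a 0 a0 (leq0n _); rewrite addn0 => H _.
  by case: x; rewrite /= a0 H.
case: x => /= rb; last by rewrite a0 IH.
by rewrite ltnn eqxx addnS -addSn IH.
Qed.

Lemma word_of_mask_nth a r b i : 0 < nth 0 (word_of_mask a r b) i -> nth false b i.
Proof.
elim: b a r i => [|x b IH] a r i; first by rewrite !nth_nil.
by case: x r i => [] [|r] [|i] //=; apply: IH.
Qed.

(** The colour of a level is well defined by [prefix_levels]. By pigeonhole [m] of the [N] levels
    share a colour, and parameters are kept at these only. *)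
Lemma prefix_ramsey a : 0 < a -> forall m (C : finType),
  exists n, forall c : seq nat -> C,
  exists2 f, rgs a f (a + m) /\ size f = n & forall g g',
    size g = m -> size g' = m -> has (leq a) g -> has (leq a) g' ->
    c (pre a (subst a g f)) = c (pre a (subst a g' f)).
Proof.
move=> a0 m C; set N := (#|C| * m).+1.
have [n H] := prefix_levels (hales_jewett a0) N C; exists n => c.
have {H} [f [Hf sf] H] := H c.
pose level i := c (pre a (subst a (nseq i 0 ++ nseq (N - i) a) f)).
have [x Hx] : exists x, m <= count (fun i => level i == x) (iota 0 N).
  apply/existsP; rewrite -[[exists _, _]]negbK negb_exists; apply/negP => /forallP H0.
  have : \sum_x count (fun i => level i == x) (iota 0 N) <= \sum_(x : C) m.
    by apply: leq_sum => x _; apply: ltnW; rewrite ltnNge; apply: H0.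
  rewrite sum_nat_const; under eq_bigr do rewrite -sum1_count big_mkcond.
  have E i : \sum_(x : C) (if level i == x then 1 else 0) = 1.
    by rewrite -big_mkcond (big_pred1 (level i)) // => y; rewrite eq_sym.
  rewrite exchange_big; under eq_bigr do rewrite E.
  by rewrite sum1_size size_iota ltnn.
pose b := [seq level i == x | i <- iota 0 N].
have sb : size b = N by rewrite size_map size_iota.
have Hw : rgs a (word_of_mask a m b) (a + m).
  by apply: rgs_word_of_mask; rewrite // count_map.
have sw : size (word_of_mask a m b) = N by rewrite size_word_of_mask.
exists (subst a (word_of_mask a m b) f).
  by split; [apply: rgs_subst; rewrite ?sw | rewrite size_subst].
suff K g : size g = m -> has (leq a) g ->
    c (pre a (subst a g (subst a (word_of_mask a m b) f))) = x.
  by move=> g g' /K{}K1 /K{}K2 /K1-> /K2->.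
move=> sg hg; rewrite substA ?sw ?(rgs_lt Hf) //.
set u := subst a g _; pose i := find (leq a) u.
have su : size u = N by rewrite size_subst.
have hu : has (leq a) u by apply: has_subst; rewrite ?sg.
have iN : i < N by rewrite -su -has_find.
(* Unmarked positions of [u] hold the constant 0, so its first parameter is at a level of colour
   [x]. *)
have : nth false b i.
  apply: (@word_of_mask_nth a m); rewrite lt0n; apply/eqP => e0.
  have := @nth_find _ 0 (leq a) u hu; rewrite (nth_map 0) ?sw // e0 sub_id //.
  by rewrite leqNgt a0.
rewrite (nth_map 0) ?size_iota // nth_iota // add0n => /eqP <-.
apply: H => //; first by rewrite size_cat !size_nseq subnKC // ltnW.
rewrite find_cat has_nseq (leqNgt a 0) a0 andbF size_nseq -(subnSK iN) /= leqnn.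
by rewrite addn0.
Qed.

(** * Induction on the number of parameters *)

(** Induction on [m]. If the first letter is the parameter [a], it serves as a constant for the rest
    and [D] applies; if it is a constant, the induction hypothesis is used for all constants at
    once. *)
Lemma fusion a k : dual_ramsey a.+1 k -> forall m (C : finType),
  exists n, forall c : seq nat -> C,
  exists2 f, rgs a f (a + m) /\ size f = n & forall w h h',
    all (fun x => x < a) w -> size h' = size h -> size w + (size h).+1 = m ->
    rgs a.+1 h (a.+1 + k) -> rgs a.+1 h' (a.+1 + k) ->
    c (subst a (w ++ a :: h) f) = c (subst a (w ++ a :: h') f).
Proof.
move=> D; elim=> [|m IH] C.
  exists 0 => c; exists [::]; first by rewrite addn0 /=.
  by move=> w h h' _ _; rewrite addnS.
have [N {}IH] := IH {ffun 'I_a -> C}; have [n {}D] := D N C.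
exists n.+1 => c.
have [f1 [Hf1 s1] H1] := D (fun h => c (a :: h)).
(* The first letter [x] also replaces the letter [a] inside [f1]; a function of [x] as colour treats
   all [x] together. *)
have [f2 [Hf2 s2] H2] := IH (fun u =>
  [ffun x : 'I_a => c (val x :: subst a (val x :: u) f1)]).
have rf2 : rgs a.+1 (map (bump a) f2) (a.+1 + m).
  by rewrite addSn; apply: rgs_bump.
have lf1 : all (fun x => x <= a + size f2) f1.
  by have := rgs_lt Hf1; rewrite s2 addSn.
exists (a :: subst a (a :: map (bump a) f2) f1).
  split; last by rewrite /= size_subst s1.
  rewrite /= ltnn eqxx /= -substS addnS -addSn; apply: rgs_subst => //.
  by rewrite size_map s2.
have K y v : subst a (y :: v) (a :: subst a (a :: map (bump a) f2) f1) =
    y :: subst a (y :: subst a v f2) f1.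
  by rewrite subst_letter subst_cons // sub_head.
case=> [|x w] h h' Hw sh /=.
  rewrite add0n => -[sm] Hh Hh'; rewrite !K -!substS.
  have R g : rgs a.+1 g (a.+1 + k) -> size g = m ->
      rgs a.+1 (subst a g f2) (a.+1 + k).
    by move=> Hg sg; rewrite -(subst_bump a a) -substS rgs_subst ?sg.
  by apply: H1; rewrite ?size_subst // R // sh.
case/andP: Hw => xa Hw; rewrite addSn => -[sm] Hh Hh'; rewrite !K.
have := H2 w h h' Hw sh sm Hh Hh' => /ffunP/(_ (Ordinal xa)).
by rewrite !ffunE.
Qed.

(** By [fusion] the tail after the first parameter can be replaced by a standard one; the colour is
    then a function of the prefix, to which [prefix_ramsey] applies. *)
Lemma dual_ramseyS a k : 0 < a -> dual_ramsey a.+1 k -> dual_ramsey a k.+1.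
Proof.
move=> a0 D m C.
have [N P] := prefix_ramsey a0 m C; have [n F] := fusion D N C.
exists n => c; have {F} [f1 [Hf1 s1] F] := F c.
(* A standard tail of length [l] when [k <= l]: the [k] remaining parameters in order, then
   zeros. *)
pose h0 l := iota a.+1 k ++ nseq (l - k) 0.
have [f2 [Hf2 s2] {}P] := P (fun w =>
  c (subst a (w ++ a :: h0 (N - (size w).+1)) f1)).
exists (subst a f2 f1).
  by split; [apply: rgs_subst; rewrite ?s2 | rewrite size_subst].
suff K g : size g = m -> rgs a g (a + k.+1) ->
   has (leq a) g /\ let w := pre a (subst a g f2) in
   c (subst a g (subst a f2 f1)) =
   c (subst a (w ++ a :: h0 (N - (size w).+1)) f1).
  move=> g g' sg sg' /(K _ sg)[hg ->] /(K _ sg')[hg' ->]; exact: P.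
move=> sg Hg.
have hg : has (leq a) g.
  apply/hasP; exists a => //; apply: (rgs_mem Hg).
  by rewrite leqnn addnS ltnS leq_addr.
split=> // w; rewrite substA ?s2 ?(rgs_lt Hf1) //.
set u := subst a g f2 in w *.
have Hu : rgs a u (a + k.+1) by apply: rgs_subst; rewrite ?sg.
have hu : has (leq a) u by apply: has_subst; rewrite ?sg.
(* The first letter of [u] that is not a constant must be [a]; after it [a] counts as a constant. *)
have [h eu Hh] : exists2 h, u = w ++ a :: h & rgs a.+1 h (a.+1 + k).
  rewrite addSnnS /w; elim: u Hu hu {w} => //= x u IH.
  rewrite /pre /=; case: leqP => [ax|xa].
    by move=> /andP[/eqP-> Hu] _; exists u.
  rewrite (ltn_eqF xa) orbF => Hu hu; case: (IH Hu hu) => h e Hh.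
  by exists h => //=; rewrite {1}e.
have su : size u = N by rewrite size_subst.
have sh : size w + (size h).+1 = N by rewrite -su eu size_cat.
have -> : N - (size w).+1 = size h by rewrite -sh addnS -addSn addKn.
rewrite eu; apply: F => //; first exact: pre_all.
  rewrite size_cat size_iota size_nseq subnKC //.
  by have := rgs_size Hh; rewrite leq_add2l.
apply: rgs_cat (rgs_iota _ _) _.
by rewrite rgs_const all_nseq ltnS leq0n orbT.
Qed.

Theorem graham_rothschild a k : 0 < a -> dual_ramsey a k.
Proof.
elim: k a => [|k IH] a a0; first exact: hales_jewett.
by apply: dual_ramseyS => //; apply: IH.
Qed.

(** * Matrices in reduced column echelon form *)

Local Open Scope ring_scope.

Definition supported_lt (F : fieldType) k (t : nat) (v : 'rV[F]_k) :=
  forall j : 'I_k, (t <= j)%N -> v 0 j = 0.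

(** Indexed by a number so that [s l] can be used directly; it is zero for [t >= k]. *)
Definition unit_row (F : fieldType) k (t : nat) : 'rV[F]_k := \row_j (j == t :> nat)%:R.

(* [s l] is the number of pivot rows among the first [l] rows of [A]. *)
Definition echelon_step (F : fieldType) n k (A : 'M[F]_(n, k)) (s : nat -> nat) (l : 'I_n) :=
  (s l.+1 = s l /\ supported_lt (s l) (row l A)) \/
  (s l.+1 = (s l).+1 /\ row l A = unit_row F k (s l)).

(** A row-by-row form of [in_E]; [echelon_in_E] and [in_E_echelon] give the two directions. *)
Definition echelon (F : fieldType) n k (A : 'M[F]_(n, k)) (s : nat -> nat) :=
  [/\ s 0 = 0, s n = k & forall l, echelon_step A s l].

Section Echelon.
Variable F : fieldType.

Lemma supported_ltW k t t' (v : 'rV[F]_k) : (t <= t')%N ->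
  supported_lt t v -> supported_lt t' v.
Proof. by move=> tt' H j t'j; apply: H; apply: leq_trans t'j. Qed.

Lemma supported_unit_row k t t' : (t < t')%N -> supported_lt t' (unit_row F k t).
Proof.
by move=> tt' j t'j; rewrite mxE; case: eqP => // jt; rewrite jt leqNgt tt' in t'j.
Qed.

Lemma unit_rowE k (i : 'I_k) : unit_row F k i = delta_mx 0 i.
Proof. by apply/rowP => j; rewrite !mxE. Qed.

Lemma supported_mulmx k t k' t' (v : 'rV[F]_k) (A : 'M[F]_(k, k')) :
  supported_lt t v -> (forall i : 'I_k, (i < t)%N -> supported_lt t' (row i A)) ->
  supported_lt t' (v *m A).
Proof.
move=> Hv HA j tj; rewrite mxE big1 // => i _.
have [it|ti] := ltnP i t; last by rewrite Hv ?mul0r.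
by have := HA i it j tj; rewrite mxE => ->; rewrite mulr0.
Qed.

Lemma supported_pid k t (v : 'rV[F]_k) : supported_lt t v -> v *m pid_mx t = v.
Proof.
move=> H; apply/rowP => j; rewrite mxE (bigD1 j) //= big1 => [|i ij].
  rewrite mxE eqxx addr0 /=; case: ltnP => [_|/H->]; last by rewrite mul0r.
  by rewrite mulr1.
by rewrite mxE val_eqE (negPf ij) mulr0.
Qed.

Lemma supported_pidP k t (v : 'rV[F]_k) : (v <= (pid_mx t : 'M_k))%MS -> supported_lt t v.
Proof.
case/submxP => w -> j tj; rewrite mxE big1 // => i _; rewrite mxE.
by case: eqP => [e|_]; rewrite ?mulr0 //= e ltnNge tj mulr0.
Qed.

Lemma echelon_mono n k (A : 'M[F]_(n, k)) s : echelon A s ->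
  forall a b, (a <= b)%N -> (b <= n)%N -> (s a <= s b)%N.
Proof.
move=> [_ _ H] a; elim=> [|b IH]; first by rewrite leqn0 => /eqP->.
rewrite leq_eqVlt => /orP[/eqP->//|ab] bn.
apply: leq_trans (IH ab (ltnW bn)) _.
by case: (H (Ordinal bn)) => [[/= -> _]|[/= -> _]].
Qed.

Lemma echelon_row_lt n k (A : 'M[F]_(n, k)) s : echelon A s ->
  forall (l : 'I_n) t, (l < t)%N -> (t <= n)%N -> supported_lt (s t) (row l A).
Proof.
move=> E l t lt tn; have := echelon_mono E lt tn.
case: E => _ _ /(_ l)[[-> Hl]|[-> ->]] st; first exact: supported_ltW Hl.
exact: supported_unit_row.
Qed.

(** A pivot row [l] of [R] picks out row [s l] of [A]; any other row combines earlier rows of [A].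
    Hence the pivots are counted by [t \o s]. *)
Lemma echelon_mul n m k (R : 'M[F]_(n, m)) (A : 'M[F]_(m, k)) s t :
  echelon R s -> echelon A t -> echelon (R *m A) (t \o s).
Proof.
move=> ER EA; have [s0 sn sS] := ER; have [t0 tm tS] := EA.
split; rewrite /= ?s0 ?sn // => l; rewrite /echelon_step /= row_mul.
have slm : (s l <= m)%N by rewrite -sn (echelon_mono ER) // ltnW.
case: (sS l) => [[-> Hl]|[sSl ->]].
  left; split=> //; apply: supported_mulmx Hl _ => i il.
  exact: (echelon_row_lt EA).
have sm : (s l < m)%N by rewrite -sSl -sn (echelon_mono ER).
have -> : unit_row F m (s l) = unit_row F m (Ordinal sm) by [].
by rewrite unit_rowE -rowE sSl; apply: (tS (Ordinal sm)).
Qed.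

Lemma colspan_ltE p q (A : 'M[F]_(p, q)) t (c : 'I_q) :
  row c (colspan_lt A t) = if (c < t)%N then (col c A)^T else 0.
Proof. by rewrite rowK. Qed.

Lemma unitspan_ltE p i : unitspan_lt F p i = pid_mx i.
Proof.
apply/row_matrixP => l; rewrite rowK; apply/rowP => c; rewrite !mxE.
case: (ltnP l i) => li; rewrite !mxE ?andbF // andbT.
by rewrite eq_sym val_eqE.
Qed.

Lemma tr_col_tr n k (A : 'M[F]_(n, k)) (l : 'I_n) : (col l A^T)^T = row l A.
Proof. by rewrite tr_col trmxK. Qed.

Lemma echelon_first n k (A : 'M[F]_(n, k)) s i : echelon A s -> (i < k)%N ->
  exists2 l, (l < n)%N & s l = i /\ s l.+1 = i.+1.
Proof.
move=> [s0 sn sS]; rewrite -sn => ik.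
have : exists l, (i < s l)%N by exists n.
case/ex_minnP => -[|l]; first by rewrite s0.
move=> Hl minl; have ln : (l < n)%N by apply: minl.
have sl : (s l <= i)%N by rewrite leqNgt; apply/negP => /minl; rewrite ltnn.
exists l => //; case: (sS (Ordinal ln)) => -[/= e _].
  by rewrite e ltnNge sl in Hl.
by rewrite e; split; [|congr _.+1]; apply/eqP; rewrite eqn_leq sl -ltnS -e Hl.
Qed.

Lemma echelon_in_E n k (A : 'M[F]_(n, k)) s : echelon A s -> in_E A.
Proof.
move=> E; have [s0 sn sS] := E; have mono := echelon_mono E.
(* The first [t] rows lie in the span of the first [s t] unit vectors, each of which occurs among
   them as a pivot row. *)
have K t : (t <= n)%N -> (colspan_lt A^T t == unitspan_lt F k (s t))%MS.
  move=> tn; rewrite unitspan_ltE; apply/andP; split; apply/row_subP => c.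
    rewrite colspan_ltE tr_col_tr; case: ifP => [ct|_]; last exact: sub0mx.
    by rewrite -(supported_pid (echelon_row_lt E ct tn)) submxMl.
  case: (ltnP c (s t)) => ct; last first.
    rewrite -unitspan_ltE rowK ltnNge ct /=; exact: sub0mx.
  have [l ln [sl sl1]] := echelon_first E (ltn_ord c).
  have lt : (l < t)%N.
    by rewrite ltnNge; apply/negP => /mono/(_ (ltnW ln)); rewrite sl leqNgt ct.
  have -> : row c (pid_mx (s t)) = row (Ordinal ln) (colspan_lt A^T t).
    rewrite -unitspan_ltE rowK ct colspan_ltE /= lt tr_col_tr.
    case: (sS (Ordinal ln)) => -[/= e H]; last by rewrite H sl unit_rowE.
    by move: e; rewrite sl sl1 => /eqP; rewrite -[X in _ == X]addn0 -addn1 eqn_add2l.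
  exact: row_sub.
have An : A = colspan_lt A^T n.
  by apply/row_matrixP => l; rewrite colspan_ltE ltn_ord tr_col_tr.
split.
  have := K n (leqnn n); rewrite -An sn unitspan_ltE => H.
  by rewrite (eqmxP H) rank_pid_mx.
have [j Hj] : exists j : nat -> nat, forall i, (i < k)%N ->
    [/\ (j i < n)%N, s (j i) = i & s (j i).+1 = i.+1].
  apply: (@choice _ _ (fun i l => (i < k)%N -> [/\ (l < n)%N, s l = i & s l.+1 = i.+1])).
  move=> i; case: (ltnP i k) => [ik|_]; last by exists 0.
  by have [l ln [sl sl1]] := echelon_first E ik; exists l.
exists k, j; split=> //.
- by move=> i /Hj[].
- move=> i1 i2 i12 i2k; have [_ e1 _] := Hj _ (ltn_trans i12 i2k).
  have [/ltnW l2 e2 _] := Hj _ i2k; rewrite ltnNge; apply/negP => l21.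
  have [/ltnW l1 _ _] := Hj _ (ltn_trans i12 i2k).
  by have := mono _ _ l21 l1; rewrite e1 e2 leqNgt i12.
- move=> i c ik ci; have [_ e1 e2] := Hj _ ik.
  apply: trmx_inj; rewrite tr_col_tr trmx_delta -unit_rowE.
  case: (sS c) => -[]; rewrite ci e1 ?e2 // => /eqP.
  by rewrite -[X in _ == X]addn0 -addn1 eqn_add2l.
- move=> i ik; case: ltnP => [/Hj[ji e1 _]|ki].
    by have := K _ (ltnW ji); rewrite e1.
  have -> : i = k by apply/eqP; rewrite eqn_leq ik.
  by have := K n (leqnn n); rewrite sn.
Qed.

Lemma in_E_echelon n k (A : 'M[F]_(n, k)) : in_E A -> exists s, echelon A s.
Proof.
case=> rA [p0 [j [p0k jq jmono jcol jspan]]].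
have An : A = colspan_lt A^T n.
  by apply/row_matrixP => l; rewrite colspan_ltE ltn_ord tr_col_tr.
have e0 : p0 = k.
  apply/eqP; rewrite eqn_leq p0k /=.
  have := jspan p0 (leqnn _); rewrite ltnn -An unitspan_ltE => H.
  by rewrite -rA (eqmxP H) rank_pid_mx.
(* The pivot positions are extended by [J k = n], as in the span condition at [i = p0]. *)
subst p0; pose J i := if (i < k)%N then j i else n.
have Jlt i1 i2 : (i1 < i2)%N -> (i2 <= k)%N -> (J i1 < J i2)%N.
  move=> i12 i2k; rewrite /J (leq_trans i12 i2k).
  case: (ltnP i2 k) => [/(jmono _ _ i12)//|_]; exact/jq/(leq_trans i12).
have JnS i : (i <= k)%N -> (J i <= n)%N.
  by move=> ik; rewrite /J; case: (ltnP i k) => // /jq/ltnW.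
have Jk : J k = n by rewrite /J ltnn.
(* As [J] increases, the least [i] with [l <= J i] is the number of pivots before row [l]. *)
pose s l := find (fun i => (l <= J i)%N) (iota 0 k.+1).
have sE l i : (i <= k)%N -> (l <= J i)%N -> (forall i', (i' < i)%N -> (J i' < l)%N) ->
    s l = i.
  move=> ik lJ H; rewrite /s -(subnKC ik) -addnS iotaD find_cat.
  rewrite size_iota has_find size_iota.
  have -> : find (fun i => (l <= J i)%N) (iota 0 i) = i.
    rewrite -[RHS](size_iota 0 i); apply: hasNfind; apply/hasPn => i'.
    by rewrite mem_iota /= add0n -ltnNge => /H.
  by rewrite ltnn /= add0n lJ addn0.
have sP l : (l <= n)%N -> [/\ (s l <= k)%N, (l <= J (s l))%N &
    forall i, (i < s l)%N -> (J i < l)%N].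
  move=> ln; have h : has (fun i => (l <= J i)%N) (iota 0 k.+1).
    by apply/hasP; exists k; rewrite ?Jk // mem_iota add0n /=.
  have sk : (s l < k.+1)%N by rewrite -[X in (_ < X)%N](size_iota 0) -has_find.
  split=> [//||i il].
    by have := nth_find 0%N h; rewrite nth_iota.
  have := before_find 0%N il; rewrite nth_iota ?(ltn_trans il) // add0n.
  by move/negbT; rewrite -ltnNge.
exists s; split=> [||l].
- by apply: sE.
- by apply: sE; rewrite ?Jk // => i ik; rewrite -Jk; apply: Jlt.
have [sk lJ H] := sP l (ltnW (ltn_ord l)).
move: lJ; rewrite leq_eqVlt => /orP[/eqP lJ|lJ]; [right|left].
  have ik : (s l < k)%N.
    by rewrite ltnNge; apply/negP => ks; move: (ltn_ord l); rewrite lJ /J (ltnNge (s l)) ks /= ltnn.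
  split.
    apply: sE => //; first by rewrite {1}lJ; apply: Jlt.
    move=> i; rewrite ltnS leq_eqVlt => /orP[/eqP->|/H/ltnW//]; by rewrite -lJ.
  rewrite -tr_col_tr (jcol (Ordinal ik)) //; last by rewrite {1}lJ /J ik.
  by rewrite trmx_delta -unit_rowE.
split; first by apply: sE => // i /H/ltnW.
(* Row [l] comes before the next pivot [J (s l)], so it lies in the span of the first [s l] unit
   vectors. *)
apply: supported_pidP; rewrite -unitspan_ltE.
rewrite -(eqmxP (jspan (s l) sk)).
have -> : row l A = row l (colspan_lt A^T (J (s l))) by rewrite colspan_ltE lJ tr_col_tr.
exact: row_sub.
Qed.

(** * Column reduction *)

(** A transposition brings the nonzero entry to position [sg], and a column operation then clears
    the rest. Both fix the vectors supported before [sg], hence the rows already treated. *)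
Lemma clear_row k (sg : nat) (v : 'rV[F]_k) (j : 'I_k) : (sg <= j)%N -> v 0 j != 0 ->
  exists2 K : 'M[F]_k, K \in unitmx &
    v *m K = unit_row F k sg /\ forall u, supported_lt sg u -> u *m K = u.
Proof.
move=> sj vj; have sk : (sg < k)%N by apply: leq_ltn_trans sj _.
pose i : 'I_k := Ordinal sk; pose P := perm_mx (tperm i j) : 'M[F]_k.
have PE (u : 'rV[F]_k) c : (u *m P) 0 c = u 0 (tperm i j c).
  have -> : P = perm_mx (tperm i j)^-1%g by rewrite tpermV.
  by rewrite -col_permE mxE.
pose w := v *m P; have wi : w 0 i != 0 by rewrite PE tpermL.
pose a := w - unit_row F k sg.
have ai : a 0 i = w 0 i - 1 by rewrite !mxE eqxx.
pose D := delta_mx i 0 : 'cV[F]_k.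
have mulD (u : 'rV[F]_k) : u *m D = (u 0 i)%:M.
  apply/matrixP => x y; rewrite !ord1 -colE !mxE eqxx mulr1n.
  by [].
(* [K] subtracts [u_i / w_i] times [a] from a row [u], so [w] goes to [w - a]; its inverse is
   [1 + D a]. *)
pose K := 1%:M - (w 0 i)^-1 *: (D *m a).
have uK (u : 'rV[F]_k) : u *m K = u - (u 0 i / w 0 i) *: a.
  by rewrite mulmxBr mulmx1 -scalemxAr mulmxA mulD mul_scalar_mx scalerA mulrC.
have KU : K \in unitmx.
  suff /mulmx1_unit[] : K *m (1%:M + D *m a) = 1%:M by [].
  have DD : D *m a *m (D *m a) = (w 0 i - 1) *: (D *m a).
    by rewrite mulmxA -(mulmxA D) mulD ai mul_mx_scalar scalemxAl.
  rewrite mulmxDr mulmx1 mulmxBl mul1mx -scalemxAl DD scalerA mulrBr mulVf //.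
  by rewrite mulr1 scalerBl scale1r subKr subrK.
exists (P *m K); first by rewrite unitmx_mul KU unitmx_perm.
split=> [|u Hu].
  by rewrite mulmxA uK divff // scale1r subKr.
have uP : u *m P = u.
  apply/rowP => c; rewrite PE; case: tpermP => [->|->|//]; by rewrite !Hu.
by rewrite mulmxA uP uK Hu // mul0r scale0r subr0.
Qed.

Lemma echelon_factor n k (A : 'M[F]_(n, k)) : \rank A = k ->
  exists A0 G s, [/\ G \in unitmx, echelon A0 s & A = A0 *m G].
Proof.
move=> rA.
have K l : (l <= n)%N -> exists (H : 'M[F]_k) s, [/\ H \in unitmx, s 0 = 0,
    (forall a, (s a <= k)%N), (forall a b, (a <= b)%N -> (s a <= s b)%N) &
    forall i : 'I_n, (i < l)%N -> echelon_step (A *m H) s i].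
  elim: l => [_|l IH ln].
    by exists 1%:M, (fun _ => 0); split; rewrite ?unitmx1.
  have [H [s [HU s0 sk mono Hs]]] := IH (ltnW ln).
  pose v := row (Ordinal ln) (A *m H).
  have supp (i : 'I_n) : (i < l)%N -> supported_lt (s l) (row i (A *m H)).
    move=> il; have := mono _ _ il; case: (Hs i il) => [[-> X]|[-> ->]] Y.
      exact: supported_ltW X.
    exact: supported_unit_row.
  (* Row [l] is a pivot row exactly when it has a nonzero entry in a column from [s l] on. *)
  case: (boolP [forall j : 'I_k, (s l <= j)%N ==> (v 0 j == 0)]) => [/forallP Hv|].
    exists H, (fun x => s (minn x l)); split=> //; first by rewrite min0n.
      by move=> a b ab; apply: mono; rewrite leq_min geq_minr (leq_trans (geq_minl _ _)).
    move=> i; rewrite ltnS leq_eqVlt => /orP[/eqP il|il].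
      have -> : i = Ordinal ln by apply: val_inj.
      left; rewrite /= minnn (minn_idPr (leqnSn l)); split=> // j sj.
      by have := Hv j; rewrite sj => /eqP.
    have := Hs i il; rewrite /echelon_step.
    by rewrite (minn_idPl il) (minn_idPl (ltnW il)).
  rewrite negb_forall => /existsP[j]; rewrite negb_imply => /andP[sj vj].
  have [K KU [vK uK]] := clear_row sj vj.
  exists (H *m K), (fun x => if (x <= l)%N then s x else (s l).+1); split=> //.
  - by rewrite unitmx_mul HU.
  - by move=> a; case: ifP => // _; apply: leq_ltn_trans sj _.
  - move=> a b ab; case: (leqP b l) => bl; first by rewrite (leq_trans ab bl) mono.
    by case: (leqP a l) => // al; rewrite leqW // mono.
  move=> i; rewrite ltnS leq_eqVlt => /orP[/eqP il|il].
    have -> : i = Ordinal ln by apply: val_inj.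
    by right; rewrite /= leqnn ltnn mulmxA row_mul.
  by rewrite /echelon_step il (ltnW il) mulmxA row_mul uK; [apply: Hs | apply: supp].
have [H [s [HU s0 sk mono Hs]]] := K n (leqnn n).
(* All rows are supported on the first [s n] columns, so rank [k] forces [s n = k]. *)
have AH : A *m H *m (pid_mx (s n) : 'M_k) = A *m H.
  apply/row_matrixP => i; rewrite row_mul supported_pid //.
  have := mono _ _ (ltn_ord i); case: (Hs i (ltn_ord i)) => [[-> X]|[-> ->]] Y.
    exact: supported_ltW X.
  exact: supported_unit_row.
have rAH : \rank (A *m H) = k by rewrite mxrankMfree // row_free_unit.
have sn : s n = k.
  apply/eqP; rewrite eqn_leq sk -{1}rAH -AH.
  by rewrite (leq_trans (mxrankM_maxr _ _)) // rank_pid_mx.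
exists (A *m H), (invmx H), s; split; first by rewrite unitmx_inv.
  by split=> // l; apply: Hs.
by rewrite mulmxK.
Qed.

End Echelon.

(** * From words to matrices *)

Section Digits.
Variable F : finFieldType.
Local Notation q := #|F|.

Definition scalars : seq F := 0 :: 1 :: [seq x <- enum F | (x != 0) && (x != 1)].
Definition scalar (d : nat) : F := nth 0 scalars d.

Lemma scalar_surj x : exists2 d, (d < q)%N & scalar d = x.
Proof.
have us : uniq scalars.
  rewrite /= inE !mem_filter !eqxx andbF /= orbF eq_sym oner_eq0 /=.
  by rewrite filter_uniq ?enum_uniq.
have xs : x \in scalars.
  by rewrite !inE mem_filter mem_enum andbT; case: eqP => //; case: eqP.
exists (index x scalars); last by rewrite /scalar nth_index.
rewrite -index_mem in xs; apply: leq_trans xs _.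
by rewrite -(card_uniqP us) max_card.
Qed.

(** Coordinate 0 is the least significant digit: for [t <= k] the numbers below [q ^ t] give the
    vectors supported on the first [t] coordinates. *)
Definition vec (k x : nat) : 'rV[F]_k := \row_j scalar ((x %/ q ^ j) %% q).

Lemma q_gt1 : (1 < q)%N.
Proof. exact: card_finNzRing_gt1. Qed.

Lemma q_gt0 : (0 < q)%N.
Proof. exact: ltnW q_gt1. Qed.

Lemma expq_gt0 l : (0 < q ^ l)%N.
Proof. by rewrite expn_gt0 q_gt0. Qed.

Lemma vec_add k l x d : (x < q ^ l)%N -> (d < q)%N ->
  vec k (x + d * q ^ l) = vec k x + scalar d *: unit_row F k l.
Proof.
move=> xl dq; apply/rowP => j; rewrite !mxE.
have [jl|lj|->] := ltngtP j l.
- rewrite mulr0 addr0 -(subnK (ltnW jl)) expnD mulnA addnC divnMDl ?expq_gt0 //.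
  by rewrite -(subnSK jl) expnSr mulnA modnMDl.
- have small y i : (y < q ^ i)%N -> (i <= j)%N -> (y %/ q ^ j)%N = 0%N.
    by move=> yi ij; rewrite divn_small // (leq_trans yi) // leq_exp2l ?q_gt1.
  rewrite (small x l) ?(ltnW lj) // (small _ l.+1) //.
    by rewrite mulr0 addr0.
  rewrite expnS (leq_trans (n := q ^ l + d * q ^ l)) ?ltn_add2r //.
  by rewrite -mulSn leq_mul2r dq orbT.
rewrite mulr1 addnC divnMDl ?expq_gt0 // divn_small // addn0 modn_small //.
by rewrite mod0n add0r.
Qed.

Lemma vec0 k : vec k 0 = 0.
Proof. by apply/rowP => j; rewrite !mxE div0n mod0n. Qed.

Lemma vec_pow k l : vec k (q ^ l) = unit_row F k l.
Proof.
have := @vec_add k l 0 1 (expq_gt0 l) q_gt1.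
by rewrite add0n mul1n vec0 add0r scale1r.
Qed.

Lemma vec_supported k l x : (x < q ^ l)%N -> supported_lt l (vec k x).
Proof.
move=> xl j lj; rewrite mxE divn_small ?mod0n //.
by rewrite (leq_trans xl) // leq_exp2l ?q_gt1.
Qed.

Lemma vec_surj k t (v : 'rV[F]_k) : (t <= k)%N -> supported_lt t v ->
  exists2 x, (x < q ^ t)%N & vec k x = v.
Proof.
elim: t v => [|t IH] v tk Hv.
  by exists 0%N => //; rewrite vec0; apply/rowP => j; rewrite mxE Hv.
pose i := Ordinal tk; pose v' := v - v 0 i *: unit_row F k t.
have [x xt xv] : exists2 x, (x < q ^ t)%N & vec k x = v'.
  apply: IH (ltnW tk) _ => j tj; rewrite !mxE.
  have [jt|jt] := eqVneq (j : nat) t.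
    by have -> : j = i; [apply: val_inj | rewrite /= mulr1 subrr].
  by rewrite mulr0 subr0 Hv // ltn_neqAle eq_sym jt.
have [d dq dv] := scalar_surj (v 0 i).
exists (x + d * q ^ t)%N; last by rewrite vec_add // xv dv subrK.
rewrite expnS (leq_trans (n := q ^ t + d * q ^ t)) ?ltn_add2r //.
by rewrite -mulSn leq_mul2r dq orbT.
Qed.

(** [g] is the map [v |-> v A] on numbers, built digit by digit. A row without pivot yields only
    vectors supported before [s l], that is, letters already used. *)
Lemma echelon_word m k (A : 'M[F]_(m, k)) s : echelon A s ->
  exists g, [/\ size g = (q ^ m)%N, rgs 0 g (q ^ k) &
    forall x, (x < q ^ m)%N -> vec k (nth 0%N g x) = vec m x *m A].
Proof.
move=> E; have [s0 sm sS] := E.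
suff /(_ m (leqnn m)) [g] : forall l, (l <= m)%N -> exists g,
    [/\ size g = (q ^ l)%N, rgs 0 g (q ^ s l) &
      forall x, (x < q ^ l)%N -> vec k (nth 0%N g x) = vec m x *m A].
  by rewrite sm; exists g.
elim=> [_|l IH lm].
  exists [:: 0%N]; split; rewrite ?s0 //=.
  by move=> x; rewrite expn0 ltnS leqn0 => /eqP->; rewrite /= !vec0 mul0mx.
have [g [sg Hg gA]] := IH (ltnW lm); pose i := Ordinal lm.
case: (sS i) => -[/= eS Hi].
  have slk : (s l <= k)%N by rewrite -sm (echelon_mono E) // ltnW.
  have [h [sh Hh hA]] : exists h, [/\ size h = (q ^ l.+1 - q ^ l)%N,
      all (fun y => (y < q ^ s l)%N) h & forall x, (x < q ^ l.+1 - q ^ l)%N ->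
      vec k (nth 0%N h x) = vec m (q ^ l + x) *m A].
    have step x : exists y, (x < q ^ l.+1 - q ^ l)%N ->
        (y < q ^ s l)%N /\ vec k y = vec m (q ^ l + x) *m A.
      have [xl|_] := boolP (x < q ^ l.+1 - q ^ l)%N; last by exists 0%N.
      have [||y] := @vec_surj k (s l) (vec m (q ^ l + x) *m A) => //; last by exists y.
      apply: (@supported_mulmx _ _ l.+1); first by apply: vec_supported; rewrite -ltn_subRL.
      by move=> j jl; rewrite -eS; apply: (echelon_row_lt E).
    have [y Hy] := choice _ step.
    exists (mkseq y (q ^ l.+1 - q ^ l)); split; first by rewrite size_mkseq.
      by apply/allP => z /mapP[x]; rewrite mem_iota => /= /Hy[? _] ->.
    by move=> x xl; rewrite nth_mkseq //; case: (Hy x xl).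
  have ql : (q ^ l <= q ^ l.+1)%N by rewrite leq_exp2l ?q_gt1.
  exists (g ++ h); split.
  - by rewrite size_cat sg sh subnKC.
  - by rewrite eS; apply: rgs_cat Hg _; rewrite rgs_const.
  move=> x xl; rewrite nth_cat sg; case: ltnP => [/gA//|lx].
  by rewrite hA ?subnKC // ltn_sub2r // (leq_ltn_trans lx).
(* At a pivot row, the block with leading digit [d] is [g] shifted by [d * q ^ s l], so new letters
   appear in order. *)
suff /(_ q (leqnn q)) [h] : forall d, (d <= q)%N -> exists h,
    [/\ size h = (d * q ^ l)%N, rgs 0 h (d * q ^ s l) &
      forall x, (x < d * q ^ l)%N -> vec k (nth 0%N h x) = vec m x *m A].
  by rewrite eS !expnS; exists h.
elim=> [_|d IHd dq]; first by exists [::]; split.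
have [h [sh Hh hA]] := IHd (ltnW dq).
exists (h ++ map (addn^~ (d * q ^ s l)%N) g); split.
- by rewrite size_cat size_map sh sg mulSn addnC.
- by apply: rgs_cat Hh _; rewrite mulSn -{1}[(d * _)%N]add0n; apply: rgs_addn.
move=> x; rewrite mulSn nth_cat sh => xl; case: ltnP => [/hA//|dx].
have xs : (x - d * q ^ l < q ^ l)%N by rewrite ltn_subLR // addnC.
have gs : (nth 0%N g (x - d * q ^ l) < q ^ s l)%N.
  by apply: (allP (rgs_lt Hg)); rewrite mem_nth ?sg.
rewrite (nth_map 0%N) ?sg // vec_add // gA // -[in RHS](subnK dx) vec_add //.
rewrite mulmxDl -scalemxAl; congr (_ + _ *: _).
have -> : unit_row F m l = unit_row F m i by [].
by rewrite unit_rowE -rowE Hi.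
Qed.

Lemma rgs_states a f b : rgs a f b -> exists st : nat -> nat,
  [/\ st 0%N = a, st (size f) = b & forall l, (l < size f)%N ->
    (st l.+1 = st l /\ (nth 0%N f l < st l)%N) \/
    (st l.+1 = (st l).+1 /\ nth 0%N f l = st l)].
Proof.
elim: f a => [|x f IH] a /=; first by move/eqP=> ab; exists (fun=> a).
case/orP=> /andP[xa /IH[st [st0 stf stS]]];
  exists (fun l => if l is l'.+1 then st l' else a); split=> // -[|l] /=;
  try exact: stS; rewrite st0 => _; first by left.
by right; rewrite (eqP xa).
Qed.

(** [st l] counts the letters available before position [l]. A new letter is a pivot when it equals
    [q ^ s l]; every other letter is below [q ^ s l]. *)
Lemma word_echelon m n f : rgs 1 f (q ^ m) -> size f = n ->
  exists s, echelon (\matrix_(l < n) vec m (nth 0%N f l)) s.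
Proof.
move=> Hf <-; have [st [st0 stf stS]] := rgs_states Hf.
exists (fun l => up_log q (st l)); split.
- by rewrite st0 up_log1.
- by rewrite stf up_expnK ?q_gt1.
move=> l; rewrite /echelon_step rowK.
have le := up_logP (st l) q_gt1.
case: (stS l (ltn_ord l)) => -[-> H].
  by left; split=> //; apply: vec_supported; apply: leq_trans le.
rewrite H; move: le; rewrite leq_eqVlt => /orP[/eqP e|lt].
  right; split; last by rewrite {1}e vec_pow.
  apply: up_log_eq q_gt1 _; rewrite expnS -e ltnSn ltn_Pmull ?q_gt1 //.
  by rewrite e expq_gt0.
left; split; last exact: vec_supported.
by apply/eqP; rewrite eqn_leq up_log_min ?q_gt1 // leq_up_log.
Qed.

(** * Ramsey theorems for matrices in RCEF *)

Lemma echelon_ramsey k m (C : finType) : exists n, forall c : 'M[F]_(n, k) -> C,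
  exists R : 'M[F]_(n, m), (exists s, echelon R s) /\
    forall A B : 'M[F]_(m, k), in_E A -> in_E B -> c (R *m A) = c (R *m B).
Proof.
(* The zero vector is the only constant; the other [q ^ k - 1] vectors are parameters. *)
have [n H] := @graham_rothschild 1 (q ^ k).-1 (ltn0Sn 0) (q ^ m).-1 C.
exists n => c.
have [f [Hf sf] Hc] := H (fun w => c (\matrix_(l < n) vec k (nth 0%N w l))).
rewrite add1n prednK ?expq_gt0 // in Hf.
exists (\matrix_(l < n) vec m (nth 0%N f l)); split; first exact: word_echelon.
have K (A : 'M[F]_(m, k)) : in_E A -> exists g,
    [/\ size g = (q ^ m).-1, rgs 1 g (1 + (q ^ k).-1) &
    (\matrix_(l < n) vec m (nth 0%N f l)) *m A =
    \matrix_(l < n) vec k (nth 0%N (subst 1 g f) l)].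
  case/in_E_echelon => s /echelon_word [[|x g] [sg Hg gA]].
    by move: (expq_gt0 m); rewrite -sg.
  (* The word of [A] starts with the zero vector, which is dropped as the constant; substituting the
     rest multiplies each row by [A]. *)
  have x0 : x = 0%N by move: Hg => /= /andP[/eqP].
  exists g; split; first by rewrite -sg.
    by rewrite add1n prednK ?expq_gt0 //; move: Hg; rewrite x0.
  apply/row_matrixP => l; rewrite row_mul !rowK -gA; last first.
    by apply: (allP (rgs_lt Hf)); rewrite mem_nth ?sf.
  by rewrite (nth_map 0%N) ?sf // x0.
move=> A B /K[g [sg Hg ->]] /K[g' [sg' Hg' ->]].
exact: Hc.
Qed.

Lemma echelon_pid n n0 : (n0 <= n)%N ->
  echelon (pid_mx n0 : 'M[F]_(n, n0)) (minn^~ n0).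
Proof.
move=> nn; split; [exact: min0n | exact/minn_idPr | move=> l].
rewrite /echelon_step /=; case: (ltnP l n0) => ln; [right|left].
  rewrite (minn_idPl ln); split=> //.
  by apply/rowP => j; rewrite !mxE ln andbT eq_sym.
rewrite (minn_idPr (leqW ln)); split=> // j.
by rewrite leqNgt ltn_ord.
Qed.

(** Appending zero rows preserves RCEF; this lets both factors of a pair have the same number of
    rows. *)
Lemma echelon_ramsey_ge k m (C : finType) : exists n0, forall n, (n0 <= n)%N ->
  forall c : 'M[F]_(n, k) -> C,
  exists R : 'M[F]_(n, m), (exists s, echelon R s) /\
    forall A B : 'M[F]_(m, k), in_E A -> in_E B -> c (R *m A) = c (R *m B).
Proof.
have [n0 H] := echelon_ramsey k m C; exists n0 => n nn c.
have [R [[s ER] HR]] := H (fun A => c (pid_mx n0 *m A)).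
exists (pid_mx n0 *m R); split; last first.
  by move=> A B EA EB; rewrite -!mulmxA; apply: HR.
by exists (s \o minn^~ n0); apply: echelon_mul (echelon_pid nn) ER.
Qed.

(** Product argument: [n1] comes first, so that functions of the second factor are finitely many
    colours for the first. *)
Lemma echelon_ramsey2 k m (C : finType) : exists n,
  forall c : 'M[F]_(n, k) -> 'M[F]_(n, k) -> C,
  exists R0 R1 : 'M[F]_(n, m), [/\ in_E R0, in_E R1 &
    forall A0 A1 B0 B1 : 'M[F]_(m, k), in_E A0 -> in_E A1 -> in_E B0 -> in_E B1 ->
      c (R0 *m A0) (R1 *m A1) = c (R0 *m B0) (R1 *m B1)].
Proof.
have [n1 H1] := echelon_ramsey k m {ffun 'M[F]_(m, k) -> C}.
have [n0 H0] := echelon_ramsey_ge k m {ffun 'M[F]_(n1, k) -> C}.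
exists (maxn n0 n1) => c; pose J := pid_mx n1 : 'M[F]_(maxn n0 n1, n1).
have [R0 [[s0 E0] HR0]] := H0 _ (leq_maxl _ _) (fun X => [ffun Y => c X (J *m Y)]).
have [R1 [[s1 E1] HR1]] := H1 (fun Y => [ffun A => c (R0 *m A) (J *m Y)]).
exists R0, (J *m R1); split.
- exact: echelon_in_E E0.
- exact: echelon_in_E (echelon_mul (echelon_pid (leq_maxr _ _)) E1).
move=> A0 A1 B0 B1 EA0 EA1 EB0 EB1; rewrite -!mulmxA.
have /ffunP/(_ A0) := HR1 _ _ EA1 EB1; rewrite !ffunE => ->.
by have /ffunP/(_ (R1 *m B1)) := HR0 _ _ EA0 EB0; rewrite !ffunE.
Qed.

End Digits.

(** * The factorisation through [tau2] and the conclusion *)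

(** Column reduction of both factors of [col_base A *m row_base A] gives a witness, so the choice in
    [tau2] meets its specification. *)
Lemma tau2_factor (F : fieldType) n k (A : 'M[F]_n) : \rank A = k ->
  exists A0 A1 : 'M[F]_(n, k), [/\ in_E A0, in_E A1 & A = A0 *m tau2 k A *m A1^T].
Proof.
move=> rA; subst k.
have [|B0 [G0 [s0 [U0 E0 e0]]]] := @echelon_factor F n _ (col_base A).
  exact/eqP/col_base_full.
have [|B1 [G1 [s1 [U1 E1 e1]]]] := @echelon_factor F n _ (row_base A)^T.
  by rewrite mxrank_tr; apply/eqP/row_base_free.
suff /(epsilon_spec (inhabits 0)) [_] : exists G : 'M[F]_(\rank A), G \in unitmx /\
    exists A0 A1, [/\ in_E A0, in_E A1 & A = A0 *m G *m A1^T] by [].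
exists (G0 *m G1^T); split; first by rewrite unitmx_mul U0 unitmx_tr.
exists B0, B1; split; [exact: echelon_in_E E0 | exact: echelon_in_E E1 |].
by rewrite -{1}(mulmx_base A) {1}e0 -[row_base A]trmxK e1 trmx_mul !mulmxA.
Qed.

Theorem theorem5p8 (F : finFieldType) (k m r : nat) :
  exists n : nat, forall c : 'M[F]_n -> 'I_r,
    exists R0 R1 : 'M[F]_(n, m),
      [/\ in_E R0, in_E R1 &
        forall A B : 'M[F]_m, \rank A = k -> \rank B = k ->
          tau2 k A = tau2 k B ->
          c (R0 *m A *m R1^T) = c (R0 *m B *m R1^T)].
Proof.
have [n H] := echelon_ramsey2 F k m {ffun 'M[F]_k -> 'I_r}; exists n => c.
have [R0 [R1 [E0 E1 HR]]] := H (fun X Y => [ffun G => c (X *m G *m Y^T)]).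
exists R0, R1; split=> // A B /tau2_factor[A0 [A1 [EA0 EA1 eA]]].
move=> /tau2_factor[B0 [B1 [EB0 EB1 eB]]] tAB.
have K X X0 X1 : X = X0 *m tau2 k X *m X1^T ->
    R0 *m X *m R1^T = R0 *m X0 *m tau2 k X *m (R1 *m X1)^T.
  by move=> eX; rewrite {1}eX trmx_mul !mulmxA.
(* The two equal functions of [G] are evaluated at the common value of [tau2]. *)
have /ffunP/(_ (tau2 k A)) := HR _ _ _ _ EA0 EA1 EB0 EB1.
by rewrite !ffunE (K _ _ _ eA) (K _ _ _ eB) -tAB.
Qed.
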